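(* Let $X$ be any abelian group with a translation-invariant metric $d_X$, and let $\alpha\in X$, with strict best-return denominators $q_1<q_2<\cdots$ (a finite or infinite sequence). Suppose that an integer $M\ge1$ satisfies $$q_{n+M}\ge2q_n$$ for every $n\ge1$ for which $q_{n+M}$ exists. Then $g_N(\alpha)\le M+1$ for every integer $N\ge2$. In particular, the conclusion holds under the stronger hypothesis that $q_{n+M}\ge q_n+q_{n+1}$ for every $n\ge 1$ for which $q_{n+M}$ exists.
   Context: Best returns. For positive integers $q$ put $\rho(q)=d_X(q\alpha,0)$. The strict best-return denominators of $\alpha$ are $q_1=1$ and $q_{n+1}=\min\{q>q_n:\rho(q)<\rho(q_n)\}$ as long as such $q$ exists; the sequence may terminate, and a zero return (if any) is retained as its final term. Nearest-neighbour distances. For $N\ge2$ let $\mathcal O_N(\alpha)=\{0,\alpha,\dots,(N-1)\alpha\}$ as a set (repetitions discarded). If it has at least two points put $\delta_N(x)=\min_{y\in\mathcal O_N(\alpha),\,y\ne x}d_X(x,y)$ and $g_N(\alpha)=\#\{\delta_N(x):x\in\mathcal O_N(\alpha)\}$; if it is a singleton, $g_N(\alpha)=0$. *)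

(* Defs.v *)
From HB Require Import structures.
From mathcomp Require Import all_boot all_order all_algebra finmap.
From mathcomp Require Import all_classical all_reals topology.

Set Implicit Arguments.
Unset Strict Implicit.
Unset Printing Implicit Defensive.

Import Order.TTheory GRing.Theory Num.Theory.

Local Open Scope fset_scope.
Local Open Scope ring_scope.

(* No compatibility between the group law and the metric is built in. *)
#[short(type="metricZmodType")]
HB.structure Definition MetricZmod (R : numDomainType) :=
  {X of Metric R X & GRing.Zmodule X}.

Definition translation_invariant (R : realType) (X : metricZmodType R) : Prop :=
  forall a x y : X, mdist (x + a) (y + a) = mdist x y.

Definition rho (R : realType) (X : metricZmodType R) (alpha : X) (q : nat) : R :=
  mdist (alpha *+ q) 0.

Definition next_return (R : realType) (X : metricZmodType R) (alpha : X)
    (q q' : nat) : Prop :=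
  [/\ (q < q')%N, rho alpha q' < rho alpha q
    & forall r, (q < r)%N -> rho alpha r < rho alpha q -> (q' <= r)%N].

(* [best_return alpha n q] means that the n-th strict best-return denominator
   exists and equals q.  Indices start at 1; the sequence stops at q_n exactly
   when no later q improves on rho alpha q_n, so a zero return is its last
   term. *)
Inductive best_return (R : realType) (X : metricZmodType R) (alpha : X) :
    nat -> nat -> Prop :=
| best_return1 : best_return alpha 1 1
| best_returnS n q q' :
    best_return alpha n q -> next_return alpha q q' ->
    best_return alpha n.+1 q'.

Definition orbit_set (R : realType) (X : metricZmodType R) (alpha : X) (N : nat) :
    {fset X} :=
  [fset alpha *+ i | i in iota 0 N].

(* The starting value [head 0 s] belongs to s as soon as s is nonempty, so this
   is the minimum of s; the value on the empty sequence is junk. *)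
Definition seq_min (R : realType) (s : seq R) : R :=
  \big[Num.min/head 0 s]_(t <- s) t.

Definition nn_dist (R : realType) (X : metricZmodType R) (alpha : X) (N : nat)
    (x : X) : R :=
  seq_min [seq mdist x y | y <- orbit_set alpha N & y != x].

Definition nn_count (R : realType) (X : metricZmodType R) (alpha : X) (N : nat) :
    nat :=
  if (2 <= #|` orbit_set alpha N|)%N
  then #|` [fset nn_dist alpha N x | x in orbit_set alpha N]|
  else 0%N.

(* Main.v *)
(** Translation invariance makes the nearest-neighbour distance of [alpha *+ i]
    the least nonzero [rho k] with [1 <= k <= t], where [t = max i (N-1-i)]
    ranges over an interval starting at [N./2]. As [t] grows, this running
    minimum changes only at best-return denominators, so the number of its
    values is at most one plus the number of best-return denominators in
    [(N./2, N-1]]. Since [N - 1 <= 2 * N./2], the growth hypothesis allows at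
    most [M] of them there. *)
Require Import Defs.
From HB Require Import structures.
From mathcomp Require Import all_boot all_order all_algebra finmap.
From mathcomp Require Import all_classical all_reals topology.
From mathcomp Require Import zify.

Set Implicit Arguments.
Unset Strict Implicit.
Unset Printing Implicit Defensive.

Import Order.TTheory GRing.Theory Num.Theory.

Local Open Scope fset_scope.
Local Open Scope ring_scope.

(** * Minimum of a finite sequence *)

Lemma seq_min_le (R : realType) (s : seq R) (t : R) : t \in s -> seq_min s <= t.
Proof.
rewrite /seq_min; elim: s (head 0 s) => //= a s IHs x0.
rewrite inE big_cons ge_min => /predU1P[->|/IHs ->]; first by rewrite lexx.
by rewrite orbT.
Qed.

Lemma seq_min_mem (R : realType) (s : seq R) (t : R) : t \in s -> seq_min s \in s.
Proof.
case: s => // a s _; rewrite /seq_min /= big_seq.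
apply: (big_ind (fun x => x \in a :: s)) => //; first exact: mem_head.
by move=> x y xs ys; rewrite minEle; case: ifP.
Qed.

(** * Records of [rho] and minima over nonzero multiples *)

Section BestReturns.

Variables (R : realType) (X : metricZmodType R) (alpha : X).

Local Notation rho := (rho alpha).

(** A decidable form of being a best-return denominator, which can be counted on intervals. *)
Definition record (q : nat) : bool :=
  (0 < q)%N && all (fun k => rho q < rho k) (iota 1 q.-1).

Lemma recordP q :
  reflect ((0 < q)%N /\ forall k, (0 < k < q)%N -> rho q < rho k) (record q).
Proof.
apply: (iffP andP) => -[q0 H]; split=> //.
  by move=> k kq; apply: (allP H); rewrite mem_iota; lia.
by apply/allP => k; rewrite mem_iota => kq; apply: H; lia.
Qed.

Definition nrecords (n : nat) : nat := count record (iota 1 n).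

Lemma nrecordsS n : nrecords n.+1 = (nrecords n + record n.+1)%N.
Proof. by rewrite /nrecords -{1}(addn1 n) iotaD count_cat /= addn0 add1n. Qed.

Lemma leq_nrecords : {homo nrecords : m n / (m <= n)%N}.
Proof.
apply: homo_leq => [//|m n p|n]; first exact: leq_trans.
by rewrite nrecordsS leq_addr.
Qed.

Lemma nrecords_cat m n : (m <= n)%N ->
  nrecords n = (nrecords m + count record (iota m.+1 (n - m)))%N.
Proof. by move=> mn; rewrite /nrecords -count_cat -add1n -iotaD subnKC. Qed.

(** The counter [nrecords] climbs by at most one at a time, so it first reaches [j] at a record. *)
Lemma exists_record n j : (0 < j <= nrecords n)%N ->
  exists q, [/\ record q, (q <= n)%N & nrecords q = j].
Proof.
elim: n => [|n IHn] jn; first by move: jn; rewrite /nrecords /=; lia.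
have [jle|jgt] := leqP j (nrecords n).
  have [|q [rq qn <-]] := IHn; first by lia.
  by exists q; split=> //; lia.
move: jn; rewrite nrecordsS; case E: (record n.+1) => jn; last by lia.
by exists n.+1; split=> //; rewrite nrecordsS E; lia.
Qed.

(** The least [k > p] with [rho k < rho p] is itself a record, so it cannot precede [q]. *)
Lemma next_return_record p q : record p -> record q -> (p < q)%N ->
  (forall r, (p < r < q)%N -> ~~ record r) -> next_return alpha p q.
Proof.
move=> /recordP[p0 Hp] /recordP[q0 Hq] pq gap; split=> //.
  by apply: Hq; rewrite p0.
move=> r pr rp; rewrite leqNgt; apply/negP => rq.
have ex : exists k, (p < k)%N && (rho k < rho p) by exists r; rewrite pr.
have [k /andP[pk kp] kmin] := ex_minnP ex.
have kr : (k <= r)%N by apply: kmin; rewrite pr.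
suff rk : record k by have /negP := gap k (ltac:(lia)).
apply/recordP; split; first by lia.
move=> i ik; have [ip|pi|->//] := ssrnat.ltngtP i p.
  by apply: lt_trans kp _; apply: Hp; lia.
apply: lt_le_trans kp _; rewrite leNgt; apply/negP => ip.
by have := kmin i; rewrite pi ip => /(_ isT); lia.
Qed.

Lemma record_best_return q : record q -> best_return alpha (nrecords q) q.
Proof.
elim/ltn_ind: q => -[|[|q]] IHq rq //; first exact: best_return1.
have cq : (0 < nrecords q.+1)%N by exact: (leq_nrecords (ltn0Sn q : (1 <= q.+1)%N)).
have [|p [rp pq cp]] := @exists_record q.+1 (nrecords q.+1); first by lia.
rewrite nrecordsS rq addn1 -cp.
apply: best_returnS (IHq p _ rp) _ => //.
apply: next_return_record => // r /andP[pr rq2]; apply/negP => rr.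
(* A record [r] strictly between [p] and the next record would push the counter above
   [nrecords p]. *)
have := @leq_nrecords r q.+1 rq2; have := @leq_nrecords p r.-1 (ltac:(lia)).
by case: r pr rq2 rr => // r pr rq2 rr; rewrite nrecordsS rr /=; lia.
Qed.

(** Among [M + 1] records in [(T, n]], the first and the last have indices differing by [M]; growth
    would place the last beyond [2 * T], hence beyond [n]. *)
Lemma count_record_window M T n : (T <= n <= 2 * T)%N ->
  (forall i q q', (1 <= i)%N -> best_return alpha i q ->
     best_return alpha (i + M)%N q' -> (2 * q <= q')%N) ->
  (count record (iota T.+1 (n - T)) <= M)%N.
Proof.
move=> /andP[Tn nT] growth; rewrite leqNgt; apply/negP => gtM.
have cn := nrecords_cat Tn.
have [|q [rq qn cq]] := @exists_record n (nrecords T).+1; first by lia.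
have [|q' [rq' qn' cq']] := @exists_record n ((nrecords T).+1 + M)%N.
  by lia.
have Tq : (T < q)%N.
  by rewrite ltnNge; apply/negP => /leq_nrecords; rewrite cq ltnn.
have := record_best_return rq; rewrite cq => bq.
have := record_best_return rq'; rewrite cq' => bq'.
by have := growth _ _ _ (ltn0Sn _) bq bq'; lia.
Qed.

(** A relation, since no minimum exists when all multiples up to [t] vanish. Zero multiples are
    excluded because they lead back to the same orbit point. *)
Definition nonzero_min (t : nat) (v : R) : Prop :=
  (exists k, [/\ (0 < k <= t)%N, alpha *+ k != 0 & rho k = v]) /\
  (forall k, (0 < k <= t)%N -> alpha *+ k != 0 -> v <= rho k).

Lemma nonzero_min_inj t v w : nonzero_min t v -> nonzero_min t w -> v = w.
Proof.
move=> [[k [kt k0 <-]] Hv] [[l [lt l0 <-]] Hw].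
by apply/eqP; rewrite eq_le Hv ?Hw.
Qed.

(** Take the least [k] attaining [v] at a nonzero multiple. If [k <= T], then [v] is already the
    minimum up to [T]; otherwise minimality makes [k] a record. *)
Lemma nonzero_min_record T t v : (T <= t)%N -> nonzero_min t v ->
  nonzero_min T v \/ exists2 q, (T < q <= t)%N & record q /\ rho q = v.
Proof.
move=> Tt [[k0 [k0t nz0 e0]] vmin].
have ex : exists k, [&& (0 < k)%N, alpha *+ k != 0 & rho k == v].
  by exists k0; rewrite nz0 e0 eqxx; move: k0t => /andP[->].
have [k /and3P[kgt0 knz /eqP ek] kmin] := ex_minnP ex.
have kt : (k <= t)%N.
  by apply: leq_trans (kmin k0 _) _; rewrite ?nz0 ?e0 ?eqxx; lia.
have [kT|Tk] := leqP k T; [left|right].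
  split; first by exists k; rewrite kgt0.
  by move=> l lT; apply: vmin; lia.
exists k; first by rewrite Tk.
split=> //; apply/recordP; split=> // l /andP[l0 lk].
have [lz|lnz] := eqVneq (alpha *+ l) 0.
  (* A period l < k would give k %% l the same multiple of alpha as k. *)
  have ekl : alpha *+ k = alpha *+ (k %% l).
    by rewrite {1}(divn_eq k l) mulrnDr mulnC mulrnA lz mul0rn add0r.
  have := kmin (k %% l)%N; rewrite /Defs.rho -ekl knz.
  have -> : (0 < k %% l)%N.
    by rewrite lt0n; apply: contraNneq knz => z; rewrite ekl z.
  by rewrite -ek /Defs.rho eqxx => /(_ isT); have := ltn_pmod k l0; lia.
rewrite lt_neqAle ek vmin ?lnz//; last by lia.
rewrite andbT; apply/negP => /eqP el.
by have := kmin l; rewrite l0 lnz -el eqxx => /(_ isT); lia.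
Qed.

(** * Nearest-neighbour distances in the orbit *)

Hypothesis d_inv : translation_invariant X.

Lemma mdist_orbit i k : mdist (alpha *+ (i + k)) (alpha *+ i) = rho k.
Proof. by rewrite -[in LHS](add0r (alpha *+ i)) addnC mulrnDr d_inv. Qed.

Lemma orbit_setP N y :
  reflect (exists2 j, (j < N)%N & y = alpha *+ j) (y \in orbit_set alpha N).
Proof.
apply: (iffP (imfsetP _ _ _ _)) => -[j jN ->]; exists j => //.
  by move: jN; rewrite /= mem_iota.
by rewrite /= mem_iota.
Qed.

(** A step [k] from index [i] stays within [[0, N-1]] in at least one direction exactly when
    [k <= maxn i (N.-1 - i)], and either direction has length [rho k]. *)
Lemma nn_dist_nonzero_min N i : (i < N)%N -> (2 <= #|` orbit_set alpha N|)%N ->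
  nonzero_min (maxn i (N.-1 - i)) (nn_dist alpha N (alpha *+ i)).
Proof.
move=> iN card2; set x := alpha *+ i.
set s := [seq mdist x y | y <- orbit_set alpha N & y != x].
have xO : x \in orbit_set alpha N by apply/orbit_setP; exists i.
have in_s k : (0 < k <= maxn i (N.-1 - i))%N -> alpha *+ k != 0 -> rho k \in s.
  move=> /andP[k0 kt] knz; have [ki|ik] := leqP k i.
    apply/mapP; exists (alpha *+ (i - k)); last first.
      by rewrite /x -{1}(subnK ki) mdist_orbit.
    rewrite mem_filter /x -{2}(subnK ki) mulrnDr eq_sym -subr_eq0 addrAC subrr.
    by rewrite add0r knz; apply/orbit_setP; exists (i - k)%N => //; lia.
  apply/mapP; exists (alpha *+ (i + k)); last by rewrite metric_sym mdist_orbit.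
  rewrite mem_filter /x mulrnDr -subr_eq0 addrAC subrr add0r knz -mulrnDr.
  by apply/orbit_setP; exists (i + k)%N => //; lia.
have s_in t : t \in s ->
    exists k, [/\ (0 < k <= maxn i (N.-1 - i))%N, alpha *+ k != 0 & rho k = t].
  case/mapP => y; rewrite mem_filter => /andP[yx /orbit_setP[j jN yj]] ->.
  move: yx; rewrite {}yj /x; have [ij|ij|->] := ssrnat.ltngtP i j; last by rewrite eqxx.
    rewrite -(subnKC (ltnW ij)) mulrnDr -subr_eq0 addrAC subrr add0r -mulrnDr.
    move=> nz; exists (j - i)%N; split=> //; first by lia.
    by rewrite metric_sym mdist_orbit.
  rewrite -(subnKC (ltnW ij)) mulrnDr eq_sym -subr_eq0 addrAC subrr add0r -mulrnDr.
  move=> nz; exists (i - j)%N; split=> //; first by lia.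
  by rewrite mdist_orbit.
(* A second orbit point makes [s] nonempty, so [seq_min] is attained and not a junk value. *)
have [y /andP[yx yO]] : exists y, (y != x) && (y \in orbit_set alpha N).
  have /fset0Pn[y] : orbit_set alpha N `\ x != fset0.
    by rewrite -cardfs_gt0; move: card2; rewrite (cardfsD1 x) xO add1n ltnS.
  by rewrite in_fsetD1 => yP; exists y.
have ys : mdist x y \in s by apply: map_f; rewrite mem_filter yx.
split; first exact: s_in (seq_min_mem ys).
by move=> k kt knz; apply: seq_min_le; apply: in_s.
Qed.

Lemma nn_count_le_records N :
  (nn_count alpha N <= (count record (iota N./2.+1 (N.-1 - N./2))).+1)%N.
Proof.
rewrite /nn_count; case: ifP => // card2.
(* [v0] is the minimum up to [T] if there is one; otherwise the default 0 is merely a spare entry of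
   [s]. *)
set T := N./2; set v0 := xget 0 [set v | nonzero_min T v].
pose s := v0 :: [seq rho q | q <- iota T.+1 (N.-1 - T) & record q].
apply: (@leq_trans (size s)); last by rewrite /= size_map size_filter.
apply: uniq_leq_size; first exact: fset_uniq.
move=> v /imfsetP[x /= /orbit_setP[i iN ->] ->]; rewrite inE.
(* The two arguments of the maximum add up to [N.-1], so the larger is at least [N./2]. *)
have Tt : (T <= maxn i (N.-1 - i))%N by rewrite /T; lia.
have [minT|[q qt [rq <-]]] :=
    nonzero_min_record Tt (nn_dist_nonzero_min iN card2).
  apply/orP; left; apply/eqP; apply: (nonzero_min_inj minT).
  exact: (@xgetPex _ 0 [set v | nonzero_min T v]) (ex_intro _ _ minT).
apply/orP; right; apply: map_f; rewrite mem_filter rq mem_iota.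
by lia.
Qed.

End BestReturns.

(** * Uniqueness and monotonicity of best returns; the growth conditions *)

Section GrowthHypotheses.

Variables (R : realType) (X : metricZmodType R) (alpha : X).

Lemma next_return_inj p q q' :
  next_return alpha p q -> next_return alpha p q' -> q = q'.
Proof.
move=> [pq rq minq] [pq' rq' minq'].
by apply/eqP; rewrite eqn_leq minq ?minq'.
Qed.

Lemma best_return_index_gt0 n q : best_return alpha n q -> (0 < n)%N.
Proof. by case. Qed.

Lemma best_returnSP n q : (0 < n)%N -> best_return alpha n.+1 q ->
  exists2 p, best_return alpha n p & next_return alpha p q.
Proof.
move=> n0 b; inversion b as [e|m p q' bp np e1 e2]; last by exists p.
by subst n.
Qed.

Lemma best_return_inj n q q' :
  best_return alpha n q -> best_return alpha n q' -> q = q'.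
Proof.
elim: n q q' => [|n IHn] q q' b b'; first by have := best_return_index_gt0 b.
have [n0|n_gt0] := posnP n.
  rewrite {}n0 in b b' IHn.
  have one p : best_return alpha 1 p -> p = 1%N.
    move=> bp; inversion bp as [|m r r' br] => //; subst m.
    by have := best_return_index_gt0 br.
  by rewrite (one _ b) (one _ b').
have [p bp np] := best_returnSP n_gt0 b.
have [p' bp' np'] := best_returnSP n_gt0 b'.
by rewrite -(IHn _ _ bp bp') in np'; apply: next_return_inj np np'.
Qed.

Lemma best_return_ltn n p q :
  best_return alpha n p -> best_return alpha n.+1 q -> (p < q)%N.
Proof.
move=> bp /(best_returnSP (best_return_index_gt0 bp))[p' bp' [pq _ _]].
by rewrite (best_return_inj bp bp').
Qed.

Lemma best_return_prefix m n q : (0 < m <= n)%N -> best_return alpha n q ->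
  exists p, best_return alpha m p.
Proof.
elim: n q => [|n IHn] q mn b; first by lia.
have [->|mSn] := eqVneq m n.+1; first by exists q.
by have [|p bp _] := best_returnSP _ b; [lia|apply: IHn bp; lia].
Qed.

Lemma nn_count_le_growth M N : translation_invariant X -> (2 <= N)%N ->
  (forall n q q' : nat, (1 <= n)%N ->
      best_return alpha n q -> best_return alpha (n + M)%N q' ->
      (2 * q <= q')%N) ->
  (nn_count alpha N <= M + 1)%N.
Proof.
move=> d_inv N2 growth; rewrite addn1.
apply: leq_trans (nn_count_le_records alpha d_inv N) _.
by rewrite ltnS; apply: count_record_window growth; lia.
Qed.

End GrowthHypotheses.

Theorem theorem2 (R : realType) (X : metricZmodType R)
    (d_inv : translation_invariant X) (alpha : X) (M : nat) (M_ge1 : (1 <= M)%N) :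
  ((forall n q q' : nat, (1 <= n)%N ->
      best_return alpha n q -> best_return alpha (n + M)%N q' ->
      (2 * q <= q')%N) ->
    forall N : nat, (2 <= N)%N -> (nn_count alpha N <= M + 1)%N)
  /\
  ((forall n q r q' : nat, (1 <= n)%N ->
      best_return alpha n q -> best_return alpha n.+1 r ->
      best_return alpha (n + M)%N q' ->
      (q + r <= q')%N) ->
    forall N : nat, (2 <= N)%N -> (nn_count alpha N <= M + 1)%N).
Proof.
split=> growth N N2; apply: nn_count_le_growth => // n q q' n1 bq bq'.
(* Since [M >= 1], the index [n.+1] is at most [n + M], so the intermediate term [r] exists; then
   [q < r] turns [q + r <= q'] into the doubling condition. *)
have [|r br] := best_return_prefix (m := n.+1) _ bq'; first by lia.
have := growth _ _ _ _ n1 bq br bq'; have := best_return_ltn bq br.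
by lia.
Qed.
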